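(* Let $X_1,\ldots,X_n$ be independent Weibull lifetimes with common shape parameter $\alpha>0$ and parameters $\lambda_1,\ldots,\lambda_n>0$, that is, $X_i$ has c.d.f. $F_i(t)=1-e^{-(\lambda_i t)^{\alpha}}$ for $t\geqslant 0$ (and $F_i(t)=0$ for $t<0$). Let $q$ be the associated relative quality function and, for $S\subseteq[n]$, let $\lambda_{\alpha}(S)=\sum_{i\in S}\lambda_i^{\alpha}$. Then for every $S\subseteq[n]$ with $S\neq\varnothing$, $$ q(S)=\sum_{K\subseteq [n]\setminus S}(-1)^{|K|}\,\frac{\lambda_{\alpha}(S)}{\lambda_{\alpha}(K\cup S)}. $$
   Context: Notation: $[n]=\{1,\ldots,n\}$. The relative quality function associated with $X_1,\ldots,X_n$ is $q\colon 2^{[n]}\to[0,1]$ defined by $q(S)=\Pr\big(\max_{i\in[n]\setminus S}X_i<\min_{j\in S}X_j\big)$, with the convention $q(\varnothing)=q([n])=1$. *)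

(* Defs.v *)
From HB Require Import structures.
From mathcomp Require Import all_boot all_order all_algebra.
From mathcomp Require Import all_classical all_reals all_analysis.
Set Implicit Arguments.
Unset Strict Implicit.
Unset Printing Implicit Defensive.
Import Order.TTheory GRing.Theory Num.Theory.
Import numFieldNormedType.Exports.
Local Open Scope classical_set_scope.
Local Open Scope ring_scope.

Definition mutually_independent (d : measure_display) (T : measurableType d)
    (R : realType) (P : probability T R) (n : nat) (X : 'I_n -> {RV P >-> R}) :
    Prop :=
  forall (J : {set 'I_n}) (B : 'I_n -> set R),
    (forall i, i \in J -> measurable (B i)) ->
    P (\bigcap_(i in [set` J]) (X i @^-1` B i)) =
    (\prod_(i in J) P (X i @^-1` B i))%E.

(* [`^] is total with [0 `^ alpha = 0] for [alpha != 0], so the case [t = 0] gives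
   the value 0 whenever [alpha > 0]. *)
Definition has_weibull_cdf (d : measure_display) (T : measurableType d)
    (R : realType) (P : probability T R) (Y : {RV P >-> R}) (alpha lambda : R) :
    Prop :=
  forall t : R,
    cdf Y t = (if 0 <= t then 1 - expR (- ((lambda * t) `^ alpha)) else 0)%:E.

(* The maximum and the minimum are taken in the extended reals because bigops
   need a neutral element; both index sets are nonempty in the last branch. *)
Definition relative_quality (d : measure_display) (T : measurableType d)
    (R : realType) (P : probability T R) (n : nat) (X : 'I_n -> {RV P >-> R})
    (S : {set 'I_n}) : R :=
  if (S == finset.set0) || (S == [set: 'I_n]%SET) then 1 else
  fine (P [set w | (\big[maxe/-oo]_(i in ~: S) (X i w)%:E
                    < \big[mine/+oo]_(j in S) (X j w)%:E)%E]).

Definition lambda_sum (R : realType) (n : nat) (lambda : 'I_n -> R) (alpha : R)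
    (S : {set 'I_n}) : R :=
  \sum_(i in S) lambda i `^ alpha.

(* Main.v *)
Require Import Defs.
From mathcomp Require Import all_boot all_order all_algebra.
From mathcomp Require Import all_classical all_reals all_analysis.
From mathcomp Require Import measurable_realfun ring lra.
Import Order.TTheory GRing.Theory Num.Theory.
Import numFieldNormedType.Exports.
Local Open Scope classical_set_scope.
Local Open Scope ring_scope.

(** The components are compared on the clock [u = t ^ alpha], that is
    [t = u ^ (1 / alpha)]: in this time scale the Weibull lifetime [X_i] becomes
    exponential of rate [a_i = lambda_i ^ alpha], and the order of the lifetimes
    does not change.  Write [a(K)] for the sum of the rates over [K],
    [F u = \prod_(i \notin S) (1 - exp (- a_i u))] for the probability that all
    components outside [S] are dead at time [u], and [G u = exp (- a(S) u)] for
    the probability that all components of [S] are alive.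

    Heuristically [q(S)] is the integral of [F] against the law of the first
    death in [S], which is exponential of rate [a(S)].  By inclusion-exclusion
    [F u] is the sum of [(-1)^|K| exp (- a(K) u)] over the [K] disjoint from [S],
    and the integral of each term is [a(S) / (a(K) + a(S))].

    The integral is replaced by Riemann sums over the slices ]kh, (k+1)h], which
    involve nothing but independence at two times.  If the first death in [S]
    falls between [u] and [v], then it is enough for [S] to outlive its
    complement that the complement is dead at [u], and it is necessary that the
    complement is dead at [v]; so the contribution of this slice to [q(S)] lies
    between [F u * (G u - G v)] and [F v * (G u - G v)] ([outlives_decrement]).
    On a regular grid both Riemann sums are combinations of geometric series,
    hence known in closed form ([geom]); comparing the decrements of two
    sequences that tend to 0 ([le_of_decrements]) avoids summing them.  This
    encloses [q(S)] for every step [h] ([outlives_bounds]), and the two bounds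
    have the same limit as [h] tends to 0, because
    [(1 - exp (- b h)) / (1 - exp (- c h))] tends to [b / c]
    ([cvg_ratio_1BexpRN]). *)

(** * Inclusion-exclusion, and limits of sequences and exponentials *)

Lemma prod_1B_sum (R : comPzRingType) (I : finType) (A : {set I}) (x : I -> R) :
  \prod_(i in A) (1 - x i) =
  \sum_(K : {set I} | K \subset A) (-1) ^+ #|K| * \prod_(i in K) x i.
Proof.
transitivity (\prod_i ((if i \in A then - x i else 0) + 1)).
  rewrite big_mkcond; apply: eq_bigr => i _.
  by case: ifP => _; rewrite ?add0r // addrC.
rewrite bigA_distr [RHS]big_mkcond /=; apply: eq_bigr => K _.
case: ifPn => [/fintype.subsetP KA | /fintype.subsetPn[i iK iA]].
  rewrite -prodrN [RHS]big_mkcond; apply: eq_bigr => i _.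
  by case: ifP => // /KA ->.
by rewrite (bigD1 i) //= iK (negbTE iA) mul0r.
Qed.

(** Both [f 0] and [g 0] are the sums of the decrements of their sequence;
    equivalently [g - f] is nonincreasing with limit 0, hence nonnegative. *)
Lemma le_of_decrements (R : realType) (f g : nat -> R) :
  f @ \oo --> 0 -> g @ \oo --> 0 ->
  (forall k, f k - f k.+1 <= g k - g k.+1) -> f 0 <= g 0.
Proof.
move=> f0 g0 fg; rewrite -subr_ge0.
have gf0 : (g - f) @ \oo --> (0 : R) by rewrite -(subr0 0); exact: cvgB.
rewrite -(cvg_lim (@Rhausdorff R) gf0).
apply: (@nonincreasing_cvgn_ge R (g - f) _ _ 0); last by apply/cvg_ex; exists 0.
apply/nonincreasing_seqP => k.
have -> : (g - f) k = g k - f k by [].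
have -> : (g - f) k.+1 = g k.+1 - f k.+1 by [].
have := fg k; lra.
Qed.

Lemma cvg_expR_at0 (R : realType) (a : R) :
  expR (a * h) @[h --> 0^'+] --> (1 : R).
Proof.
apply: cvg_at_right_filter; rewrite -[X in _ --> X]expR0 -[X in expR X](mulr0 a).
by apply: (cvg_comp ( *%R a) expR); [exact: mulrl_continuous | exact: continuous_expR].
Qed.

(** Squeezed by means of [x exp (- x) <= 1 - exp (- x) <= x], whose two halves are
    [1 + y <= exp y] at [y = x] and at [y = - x]. *)
Lemma cvg_ratio_1BexpRN (R : realType) (b c : R) : 0 < b -> 0 < c ->
  (1 - expR (- (b * h))) / (1 - expR (- (c * h))) @[h --> 0^'+] --> b / c.
Proof.
move=> b0 c0.
have bounds (x : R) : 0 < x -> x * expR (- x) <= 1 - expR (- x) <= x.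
  move=> x0; have := expR_ge1Dx (- x); have := expR_ge1Dx x.
  have := expR_gt0 (- x); have : expR x * expR (- x) = 1 by rewrite -expRD subrr expR0.
  move=> e1 p0 h1 h2; apply/andP; split; last lra.
  rewrite lerBrDr -[X in _ + X]mul1r -mulrDl -e1 addrC ler_wpM2r //; lra.
apply: (@squeeze_cvgr _ _ _ _ (fun h => b / c * expR (- b * h))
  (fun h => b / c * expR (c * h))); last 2 first.
- by rewrite -[X in _ --> X]mulr1; apply: cvgMr; exact: cvg_expR_at0.
- by rewrite -[X in _ --> X]mulr1; apply: cvgMr; exact: cvg_expR_at0.
near=> h; have h0 : 0 < h by near: h; exact: nbhs_right_gt.
have bh := mulr_gt0 b0 h0; have ch := mulr_gt0 c0 h0.
have /andP[b1 b2] := bounds _ bh; have /andP[c1 c2] := bounds _ ch.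
have cp : 0 < 1 - expR (- (c * h)).
  by apply: lt_le_trans c1; rewrite mulr_gt0 ?expR_gt0.
apply/andP; split.
  rewrite ler_pdivlMr //; apply: le_trans b1.
  apply: (@le_trans _ _ (b / c * expR (- b * h) * (c * h))).
    by rewrite ler_wpM2l // mulr_ge0 ?expR_ge0 // divr_ge0 ?ltW.
  by rewrite mulNr le_eqVlt; apply/orP; left; apply/eqP; field; rewrite gt_eqF.
rewrite ler_pdivrMr //; apply: (le_trans b2).
apply: (@le_trans _ _ (b / c * expR (c * h) * (c * h * expR (- (c * h))))).
  rewrite le_eqVlt; apply/orP; left; apply/eqP.
  have e1 : expR (c * h) * expR (- (c * h)) = 1 by rewrite -expRD subrr expR0.
  transitivity (b * h * (expR (c * h) * expR (- (c * h)))); first by rewrite e1 mulr1.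
  by field; rewrite gt_eqF.
by rewrite ler_wpM2l // mulr_ge0 ?expR_ge0 // divr_ge0 ?ltW.
Unshelve. all: by end_near. Qed.

(** * Exponential lifetimes on a common clock *)

Section race.
Context {d : measure_display} {T : measurableType d} {R : realType}.
(* [tau u] is the physical time at which the clock shows [u]; on this clock the
   lifetime [X i] is exponential of rate [a i]. *)
Context (P : probability T R) {n : nat} (X : 'I_n -> {RV P >-> R}).
Context (S : {set 'I_n}) (a : 'I_n -> R) (tau : R -> R).

Let pr (A : set T) : R := fine (P A).

Definition outlives : set T :=
  [set w | forall i j, i \notin S -> j \in S -> X i w < X j w].

Definition alive (u : R) : set T :=
  \bigcap_(j in [set` S]) (X j @^-1` `]tau u, +oo[).

Definition others_dead (u : R) : set T :=
  \bigcap_(i in [set` ~: S]) (X i @^-1` `]-oo, tau u]).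

Lemma measurable_outlives : measurable outlives.
Proof.
have -> : outlives = \bigcap_(i in [set` ~: S]) \bigcap_(j in [set` S])
    ((fun w => X j w - X i w) @^-1` `]0, +oo[).
  apply/seteqP; split=> w /= h.
    move=> i /=; rewrite inE => iS j /= jS; rewrite /= in_itv /= andbT subr_gt0.
    exact: h.
  move=> i j iS jS; have := h i; rewrite /= inE => /(_ iS j jS).
  by rewrite /= in_itv /= andbT subr_gt0.
apply: fin_bigcap_measurable => [|i _]; first exact: finite_finset.
apply: fin_bigcap_measurable => [|j _]; first exact: finite_finset.
rewrite -[X in measurable X]setTI.
by apply: (measurable_funB _ _) => //; exact: measurable_funPT.
Qed.

Lemma measurable_alive u : measurable (alive u).
Proof.
apply: fin_bigcap_measurable => [|j _]; first exact: finite_finset.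
exact: measurable_funPTI.
Qed.

Lemma measurable_others_dead u : measurable (others_dead u).
Proof.
apply: fin_bigcap_measurable => [|j _]; first exact: finite_finset.
exact: measurable_funPTI.
Qed.

Let mE := measurable_alive.
Let mM := measurable_others_dead.
Let mA := measurable_outlives.

Lemma pr_le A B : measurable A -> measurable B -> A `<=` B -> pr A <= pr B.
Proof.
move=> hA hB AB; apply: fine_le; try exact: fin_num_measure.
by apply: le_measure; rewrite ?inE.
Qed.

Lemma pr_diff A B : measurable A -> measurable B ->
  pr (A `\` B) = pr A - pr (A `&` B).
Proof.
move=> hA hB; have hAB := measurableI _ _ hA hB.
rewrite /pr measureD // ?fineB //; try exact: fin_num_measure.
by rewrite ltey_eq fin_num_measure.
Qed.

Context (X_indep : mutually_independent X).
Context (tau_homo : forall u v : R, 0 <= u -> u <= v -> tau u <= tau v).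
Context (X_tail : forall i (u : R), 0 <= u ->
  fine (P (X i @^-1` `]tau u, +oo[)) = expR (- (a i * u))).

Let F u := \prod_(i in ~: S) (1 - expR (- (a i * u))).
Let G u := \prod_(i in S) expR (- (a i * u)).

Lemma pr_indep (J : {set 'I_n}) (B : 'I_n -> set R) :
  (forall i, measurable (B i)) ->
  pr (\bigcap_(i in [set` J]) (X i @^-1` B i)) =
  \prod_(i in J) pr (X i @^-1` B i).
Proof.
move=> mB; rewrite /pr X_indep //.
rewrite (eq_bigr (fun i => (fine (P (X i @^-1` B i)))%:E)); first by rewrite prodEFin.
by move=> i _; rewrite fineK // fin_num_measure //; exact: measurable_funPTI.
Qed.

Lemma pr_dead i u : 0 <= u ->
  pr (X i @^-1` `]-oo, tau u]) = 1 - expR (- (a i * u)).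
Proof.
move=> u0; rewrite -X_tail // /pr -setCitvr preimage_setC.
have m : measurable (X i @^-1` `]tau u, +oo[) by exact: measurable_funPTI.
by rewrite probability_setC // fineB // fin_num_measure.
Qed.

Lemma pr_alive u : 0 <= u -> pr (alive u) = G u.
Proof.
move=> u0; rewrite pr_indep //; apply: eq_bigr => i _; exact: X_tail.
Qed.

(** Every index carries exactly one of the two constraints, so independence of the
    whole family applies, with a Borel set that depends on whether the index is
    in [S]. *)
Lemma pr_dead_alive u v : 0 <= u -> 0 <= v ->
  pr (others_dead u `&` alive v) = F u * G v.
Proof.
move=> u0 v0.
have -> : others_dead u `&` alive v =
    \bigcap_(i in [set` [set: 'I_n]%SET])
      (X i @^-1` [set` if i \in S then `]tau v, +oo[ else `]-oo, tau u]]).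
  apply/seteqP; split=> w.
    move=> [h1 h2] i _ /=; case: ifPn => iS; first exact: h2.
    by apply: h1; rewrite /= inE.
  move=> h; split=> i /=.
    by rewrite inE => iS; have := h i; rewrite /= inE (negbTE iS); exact.
  by move=> iS; have := h i; rewrite /= inE iS; exact.
rewrite pr_indep //.
rewrite (bigID (fun i => i \in S)) [RHS]mulrC /=; congr (_ * _).
  by apply: eq_big => i; rewrite inE //= => ->; exact: X_tail.
apply: eq_big => i; first by rewrite !inE.
by rewrite inE => /andP[_ /negbTE ->]; exact: pr_dead.
Qed.

(** The decrements of [phi] are the contributions of the time slices, sorted by
    the first death in [S], to the probability of [outlives]. *)
Let phi u := pr (outlives `&` alive u).

Lemma alive_anti u v : 0 <= u -> u <= v -> alive v `<=` alive u.
Proof.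
move=> u0 uv w h j jS; have := h j jS; rewrite /= !in_itv /= !andbT.
by apply: le_lt_trans; exact: tau_homo.
Qed.

(** Between [u] and [v] some component of [S] dies while all were alive at [u].
    If the others were dead at [u], they died first; conversely, if [S] outlives
    them, they are dead at [v] since that component is. *)
Lemma outlives_decrement u v : 0 <= u -> u <= v ->
  F u * (G u - G v) <= phi u - phi v <= F v * (G u - G v).
Proof.
move=> u0 uv; have v0 := le_trans u0 uv.
have EE : alive u `&` alive v = alive v by apply/setIidPr; exact: alive_anti.
have slice B : measurable B ->
    pr ((B `&` alive u) `\` alive v) = pr (B `&` alive u) - pr (B `&` alive v).
  by move=> mB; rewrite pr_diff -?setIA ?EE //; exact: measurableI.
rewrite !mulrBr -!pr_dead_alive // -!slice //.
have mD B : measurable B -> measurable ((B `&` alive u) `\` alive v).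
  by move=> mB; apply: measurableD => //; exact: measurableI.
apply/andP; split; apply: pr_le; try exact: mD.
- move=> w [[hM hE] hV]; split=> //; split=> // i j iS jS.
  have := hE j jS; have := hM i; rewrite /= inE => /(_ iS).
  by rewrite !in_itv /= andbT; exact: le_lt_trans.
- move=> w [[hA hE] hV]; split=> //; split=> // i /=; rewrite inE => iS.
  rewrite in_itv /= leNgt; apply/negP => iv; apply: hV => j jS /=.
  by rewrite in_itv /= andbT; apply: lt_trans iv _; exact: hA.
Qed.

(** * Riemann sums on a regular grid *)

Context (a_gt0 : forall i, 0 < a i) (S_neq0 : S != finset.set0).

Let rate (K : {set 'I_n}) := \sum_(i in K) a i.

Let rate_gt0 K : 0 < rate (K :|: S).
Proof.
have /set0Pn[j jS] := S_neq0.
rewrite /rate (bigD1 j) /= ?inE ?jS ?orbT // ltr_pwDl //.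
by apply: sumr_ge0 => i _; exact: ltW.
Qed.

Let rateS_gt0 : 0 < rate S.
Proof. by rewrite -(finset.set0U S). Qed.

Let prod_expR (K : {set 'I_n}) u :
  \prod_(i in K) expR (- (a i * u)) = expR (- (rate K * u)).
Proof. by rewrite -expR_sum sumrN mulr_suml. Qed.

Let rateU (K : {set 'I_n}) : K \subset ~: S -> rate (K :|: S) = rate K + rate S.
Proof.
rewrite -finset.disjoints_subset => KS; rewrite /rate -bigU //.
by apply: eq_bigl => i; rewrite inE.
Qed.

(** The tail, from index [k] on, of a Riemann sum of step [h] for the integral of
    [F] against the law of the first death in [S]: expanding [F] by
    inclusion-exclusion gives for each [K] a geometric series of ratio
    [exp (- rate (K :|: S) * h)].  The weight [s K] is 1 when [F] is evaluated at
    the left end of each slice and [exp (- rate K * h)] at the right end. *)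
Let geom (s : {set 'I_n} -> R) (h : R) (k : nat) : R :=
  \sum_(K : {set 'I_n} | K \subset ~: S)
    (-1) ^+ #|K| * (s K * ((1 - expR (- (rate S * h)))
                           / (1 - expR (- (rate (K :|: S) * h)))))
    * expR (- (rate (K :|: S) * h)) ^+ k.

Let expRN_lt1 (x : R) : 0 < x -> expR (- x) < 1.
Proof. by move=> x0; rewrite expR_lt1 oppr_lt0. Qed.

Let cvg_expRN (x : R) : 0 < x -> expR (- x) ^+ k @[k --> \oo] --> (0 : R).
Proof. by move=> x0; apply: cvg_expr; rewrite ger0_norm ?expR_ge0 ?expRN_lt1. Qed.

Lemma geom_cvg0 s h : 0 < h -> geom s h @ \oo --> (0 : R).
Proof.
move=> h0; have -> : (0 : R) = \sum_(K : {set 'I_n} | K \subset ~: S) 0 by rewrite big1.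
apply: cvg_big => [|K _]; first exact: add_continuous.
rewrite -[X in _ --> X](mulr0 ((-1) ^+ #|K| * (s K * ((1 - expR (- (rate S * h)))
                           / (1 - expR (- (rate (K :|: S) * h))))))).
by apply: cvgMr; apply: cvg_expRN; rewrite mulr_gt0.
Qed.

(** The decrement of the tail is one term of the Riemann sum; [u] is the end of
    the slice at which [F] is evaluated, and [s] has to account for it. *)
Lemma geom_decrement s u h k : 0 < h ->
  (forall K, expR (- (rate K * u)) = s K * expR (- (rate K * (h * k%:R)))) ->
  geom s h k - geom s h k.+1 = F u * (G (h * k%:R) - G (h * k.+1%:R)).
Proof.
move=> h0 su; rewrite /F /G prod_1B_sum !prod_expR mulr_suml /geom -sumrB.
apply: eq_bigr => K KS; rewrite prod_expR su rateU //.
have := rate_gt0 K; rewrite rateU // => c0.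
have : 1 - expR (- ((rate K + rate S) * h)) != 0.
  by rewrite subr_eq0 eq_sym lt_eqF // expRN_lt1 // mulr_gt0.
have e (x : R) (m : nat) : expR (- (x * (h * m%:R))) = expR (- (x * h)) ^+ m.
  by rewrite -expRM_natr; congr expR; ring.
rewrite !e !exprS mulrDl opprD expRD exprMn => nz; field.
by rewrite nz.
Qed.

Lemma phi_cvg0 h : 0 < h -> phi (h * k%:R) @[k --> \oo] --> (0 : R).
Proof.
move=> h0; apply: (@squeeze_cvgr _ _ _ _ (fun=> 0)
    (fun k => expR (- (rate S * h)) ^+ k)); last 2 first.
- exact: cvg_cst.
- by apply: cvg_expRN; rewrite mulr_gt0.
apply: nearW => k; have hk : 0 <= h * k%:R by rewrite mulr_ge0 // ltW.
apply/andP; split; first exact: fine_ge0.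
rewrite -expRM_natr mulNr -mulrA -prod_expR -[leRHS]pr_alive //.
by apply: pr_le => //; exact: measurableI.
Qed.

(** All lifetimes in [S] exceed [tau 0] almost surely. *)
Lemma phi0 : phi 0 = pr outlives.
Proof.
apply/eqP; rewrite eq_le; apply/andP; split.
  by apply: pr_le => //; exact: measurableI.
rewrite -subr_le0 -pr_diff //.
have pr_dead0 : pr (setT `\` alive 0) = 0.
  rewrite pr_diff // setTI pr_alive // /G big1.
    by rewrite /pr probability_setT subrr.
  by move=> i _; rewrite mulr0 oppr0 expR0.
rewrite -[leRHS]pr_dead0.
by apply: pr_le; [exact: measurableD | exact: measurableD | move=> w []].
Qed.

Lemma outlives_bounds h : 0 < h ->
  geom (fun=> 1) h 0 <= pr outlives
  <= geom (fun K => expR (- (rate K * h))) h 0.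
Proof.
move=> h0.
have hk k : 0 <= h * k%:R by rewrite mulr_ge0 // ltW.
have dec k : F (h * k%:R) * (G (h * k%:R) - G (h * k.+1%:R)) <=
    phi (h * k%:R) - phi (h * k.+1%:R) <=
    F (h * k.+1%:R) * (G (h * k%:R) - G (h * k.+1%:R)).
  by apply: outlives_decrement => //; rewrite ler_pM2l // ler_nat.
have -> : pr outlives = phi (h * 0%:R) by rewrite mulr0 phi0.
apply/andP; split.
- apply: (@le_of_decrements _ _ (fun k => phi (h * k%:R))).
  + exact: geom_cvg0.
  + exact: phi_cvg0.
  + move=> k; rewrite (@geom_decrement _ (h * k%:R)) // => [|K]; last by rewrite mul1r.
    by have /andP[] := dec k.
- apply: (@le_of_decrements _ (fun k => phi (h * k%:R))).
  + exact: phi_cvg0.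
  + exact: geom_cvg0.
  + move=> k; rewrite (@geom_decrement _ (h * k.+1%:R)) // => [|K].
      by have /andP[] := dec k.
    by rewrite -expRD; congr expR; rewrite -natr1; ring.
Qed.

Lemma geom_cvg s : (forall K, s K h @[h --> 0^'+] --> (1 : R)) ->
  geom (s ^~ h) h 0 @[h --> 0^'+] -->
  \sum_(K : {set 'I_n} | K \subset ~: S)
    (-1) ^+ #|K| * (rate S / rate (K :|: S)).
Proof.
move=> s1; apply: cvg_big => [|K _]; first exact: add_continuous.
rewrite -[rate S / _]mul1r -[X in _ --> X]mulr1.
apply: cvgM; last exact: cvg_cst.
apply: cvgMr; apply: cvgM; first exact: s1.
by apply: cvg_ratio_1BexpRN.
Qed.

(** The two enclosing sums of [outlives_bounds] differ only by the weights, which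
    tend to 1, so they squeeze the probability to their common limit. *)
Theorem pr_outlives :
  fine (P outlives) =
  \sum_(K : {set 'I_n} | K \subset ~: S)
    (-1) ^+ #|K| * (rate S / rate (K :|: S)).
Proof.
have s0 (K : {set 'I_n}) : (1 : R) @[h --> (0 : R)^'+] --> (1 : R) by exact: cvg_cst.
have lo := geom_cvg (fun _ _ => 1) s0.
have s1 (K : {set 'I_n}) : expR (- (rate K * h)) @[h --> 0^'+] --> (1 : R).
  by under eq_fun do rewrite -mulNr; exact: cvg_expR_at0.
have hi := geom_cvg (fun K h => expR (- (rate K * h))) s1.
apply/eqP; rewrite eq_le; apply/andP; split.
- apply: (cvgr_to_ge hi); near=> h.
  by have /outlives_bounds/andP[] : 0 < h by near: h; exact: nbhs_right_gt.
- apply: (cvgr_to_le lo); near=> h.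
  by have /outlives_bounds/andP[] : 0 < h by near: h; exact: nbhs_right_gt.
Unshelve. all: by end_near. Qed.

End race.

(** * Weibull lifetimes *)

(** The max-min form and the pairwise form agree because [-oo] and [+oo] are
    strictly beyond all real lifetimes.  For [S] the whole index set the pairwise
    condition is void, which matches the convention that the
    relative quality is then 1. *)
Lemma relative_qualityE (d : measure_display) (T : measurableType d)
    (R : realType) (P : probability T R) (n : nat) (X : 'I_n -> {RV P >-> R})
    (S : {set 'I_n}) : S != finset.set0 ->
  relative_quality X S = fine (P (outlives P X S)).
Proof.
move=> S0; rewrite /relative_quality (negbTE S0) /=; case: eqP => [ST|_].
  have -> : outlives P X S = setT.
    by apply/seteqP; split=> // w _ i j; rewrite ST inE.
  by rewrite probability_setT.
congr (fine (P _)); apply/seteqP; split=> w /=.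
  move=> /bigmax_ltP[_ Xlt] i j iS jS.
  have : i \in ~: S by rewrite inE.
  by move=> /Xlt /bigmin_gtP[_ /(_ _ jS)]; rewrite lte_fin.
move=> Xlt; apply: bigmax_lt => [|i].
  by apply: lt_bigmin => // j _; rewrite ltNye.
rewrite inE => iS; apply: lt_bigmin => [|j jS]; first exact: ltry.
by rewrite lte_fin; exact: Xlt.
Qed.

(** [(lambda * u ^ (1 / alpha)) ^ alpha = lambda ^ alpha * u]: the clock
    [u = t ^ alpha] turns a Weibull lifetime into an exponential one. *)
Lemma weibull_tail (d : measure_display) (T : measurableType d)
    (R : realType) (P : probability T R) (Y : {RV P >-> R}) (alpha lambda : R) :
  0 < alpha -> 0 < lambda -> has_weibull_cdf Y alpha lambda ->
  forall u : R, 0 <= u ->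
  fine (P (Y @^-1` `]u `^ alpha^-1, +oo[)) = expR (- (lambda `^ alpha * u)).
Proof.
move=> alpha0 lambda0 Yw u u0; have := Yw (u `^ alpha^-1).
rewrite powR_ge0 powRM ?powR_ge0 ?ltW // -powRrM mulVf ?gt_eqF // powRr1 //.
rewrite /cdf /distribution /pushforward => PY.
have mY : measurable (Y @^-1` `]-oo, u `^ alpha^-1]) by exact: measurable_funPTI.
rewrite -setCitvl -preimage_setC probability_setC //.
by rewrite PY /= opprB addrC subrK.
Qed.

Theorem corollary4 (d : measure_display) (T : measurableType d) (R : realType)
    (P : probability T R) (n : nat) (X : 'I_n -> {RV P >-> R})
    (alpha : R) (lambda : 'I_n -> R)
    (alpha_gt0 : 0 < alpha)
    (lambda_gt0 : forall i, 0 < lambda i)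
    (X_indep : mutually_independent X)
    (X_weibull : forall i, has_weibull_cdf (X i) alpha (lambda i))
    (S : {set 'I_n}) (S_neq0 : S != finset.set0) :
  relative_quality X S =
  \sum_(K : {set 'I_n} | K \subset ~: S)
    (-1) ^+ #|K| * (lambda_sum lambda alpha S
                    / lambda_sum lambda alpha (K :|: S)).
Proof.
rewrite relative_qualityE //; apply: (@pr_outlives _ _ _ P _ X S
  (fun i => lambda i `^ alpha) (fun u => u `^ alpha^-1)) => //.
- move=> u v u0 uv; have v0 := le_trans u0 uv.
  by apply: ge0_ler_powR; rewrite ?nnegrE // invr_ge0 ltW.
- by move=> i u u0; exact: (weibull_tail _ _ _ P (X i) alpha (lambda i)).
- by move=> i; rewrite powR_gt0.
Qed.
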